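(* Let $\Omega$ be an atomless Borel probability space with measure $\nu$, let $W:\Omega^2\to[0,1]$ be a graphon, and let $e=\int_{\Omega^2}W\,d\nu^{\otimes 2}$. Then $$\mathsf{fcov}(W)\ \ge\ \min\left\{\sqrt{\tfrac14 e},\ 1-\sqrt{1-e}\right\},$$ where the minimum is attained by the term $1-\sqrt{1-e}$ for $e\le 0.64$ and by the term $\sqrt{\tfrac14 e}$ for $e\ge 0.64$. Furthermore, equality $\mathsf{fcov}(W)=\min\{\sqrt{\frac14 e},1-\sqrt{1-e}\}$ holds if and only if $W$ is isomorphic to $\Psi_e$ (if $e\le 0.64$) or to $\Phi_e$ (if $e\ge 0.64$); for $e=0.64$ both possibilities are allowed.
   Context: A graphon is a symmetric measurable function $W:\Omega^2\to[0,1]$. Write $\operatorname{supp} W=\{(x,y): W(x,y)>0\}$. A fractional vertex cover of $W$ is a function $\mathfrak c\in L^\infty(\Omega)$ such that $0\le\mathfrak c\le 1$ almost everywhere and the set $\operatorname{supp}W\setminus\{(x,y):\mathfrak c(x)+\mathfrak c(y)\ge 1\}$ has $\nu^{\otimes 2}$-measure $0$; its size is $\|\mathfrak c\|=\int_\Omega\mathfrak c\,d\nu$. The fractional cover number $\mathsf{fcov}(W)$ is the infimum of the sizes of all fractional vertex covers of $W$. For $e\in[0,1]$ the graphons $\Psi_e$ and $\Phi_e$ are defined as follows. Partition $\Omega=B_1\sqcup B_2$ into measurable sets with $\nu(B_1)=1-\sqrt{1-e}$, $\nu(B_2)=\sqrt{1-e}$; $\Psi_e$ is $0$ on $B_2\times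 B_2$ and $1$ elsewhere. Partition $\Omega=C_1\sqcup C_2$ into measurable sets with $\nu(C_1)=\sqrt e$, $\nu(C_2)=1-\sqrt e$; $\Phi_e$ is $1$ on $C_1\times C_1$ and $0$ elsewhere. These are determined up to isomorphism; ''$W$ is isomorphic to $\Psi_e$ (respectively $\Phi_e$)'' means that $W$ equals almost everywhere the graphon $\Psi_e$ (respectively $\Phi_e$) built from some partition of $\Omega$ with the prescribed measures. *)

(* Defs.v *)
From HB Require Import structures.
From mathcomp Require Import all_boot all_order all_algebra.
From mathcomp Require Import all_classical all_reals all_analysis.

Set Implicit Arguments.
Unset Strict Implicit.
Unset Printing Implicit Defensive.

Import Order.TTheory GRing.Theory Num.Theory.
Import numFieldNormedType.Exports.

Local Open Scope classical_set_scope.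
Local Open Scope ring_scope.

(* [T] is isomorphic, as a measurable space, to a Polish space [X] (complete,
   metric, separable) with its Borel sigma-algebra. A complete pseudometric
   space is metric as soon as it is Hausdorff. *)
Definition standard_borel (R : realType) (d : measure_display)
    (T : measurableType d) : Prop :=
  exists (X : completePseudoMetricType R) (h : T -> X),
    [/\ bijective h,
        hausdorff_space X,
        exists2 D : set X, countable D & dense D
      & forall A : set T, measurable A <-> <<s [set U : set X | open U] >> (h @` A)].

Definition is_atom (R : realType) (d : measure_display) (T : measurableType d)
    (nu : {measure set T -> \bar R}) (A : set T) : Prop :=
  [/\ measurable A, (0 < nu A)%E
    & forall B : set T, measurable B -> B `<=` A -> nu B = 0%E \/ nu B = nu A].

Definition atomless (R : realType) (d : measure_display) (T : measurableType d)
    (nu : {measure set T -> \bar R}) : Prop :=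
  forall A : set T, ~ is_atom nu A.

Record graphon (R : realType) (d : measure_display) (T : measurableType d)
    (W : T * T -> R) : Prop := Graphon {
  graphon_measurable : measurable_fun [set: T * T] W ;
  graphon_sym : forall x y, W (x, y) = W (y, x) ;
  graphon_range : forall z, 0 <= W z <= 1 }.

Definition supp (R : realType) (T : Type) (W : T * T -> R) : set (T * T) :=
  [set z | 0 < W z].

Record fractional_vertex_cover (R : realType) (d : measure_display)
    (T : measurableType d) (nu : probability T R) (W : T * T -> R)
    (c : T -> R) : Prop := FractionalVertexCover {
  fvc_Linfty : c \in Lfun nu +oo%E ;
  fvc_range : {ae nu, forall x, 0 <= c x <= 1} ;
  fvc_cover : (nu \x nu)%E (supp W `\` [set z | 1 <= c z.1 + c z.2]) = 0%E }.

Definition cover_size (R : realType) (d : measure_display)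
    (T : measurableType d) (nu : probability T R) (c : T -> R) : R :=
  \int[nu]_x c x.

Definition fcov (R : realType) (d : measure_display) (T : measurableType d)
    (nu : probability T R) (W : T * T -> R) : R :=
  inf [set cover_size nu c | c in fractional_vertex_cover nu W].

Definition measurable_partition2 (d : measure_display) (T : measurableType d)
    (A B : set T) : Prop :=
  [/\ measurable A, measurable B, A `&` B = set0 & A `|` B = [set: T]].

Definition Psi (R : realType) (T : Type) (B2 : set T) : T * T -> R :=
  \1_(~` (B2 `*` B2)).

Definition Phi (R : realType) (T : Type) (C1 : set T) : T * T -> R :=
  \1_(C1 `*` C1).

Definition isomorphic_to_Psi (R : realType) (d : measure_display)
    (T : measurableType d) (nu : probability T R) (e : R)
    (W : T * T -> R) : Prop :=
  exists B1 B2 : set T,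
    [/\ measurable_partition2 B1 B2,
        nu B1 = (1 - Num.sqrt (1 - e))%:E,
        nu B2 = (Num.sqrt (1 - e))%:E
      & {ae (nu \x nu)%E, forall z, W z = Psi R B2 z}].

Definition isomorphic_to_Phi (R : realType) (d : measure_display)
    (T : measurableType d) (nu : probability T R) (e : R)
    (W : T * T -> R) : Prop :=
  exists C1 C2 : set T,
    [/\ measurable_partition2 C1 C2,
        nu C1 = (Num.sqrt e)%:E,
        nu C2 = (1 - Num.sqrt e)%:E
      & {ae (nu \x nu)%E, forall z, W z = Phi R C1 z}].

(* Main.v *)
(* Rounding a fractional cover [c] at a uniformly random threshold [s] in [0, 1/2] gives
   a cover with values 0, 1/2, 1 and expected size at most that of [c]: put 1
   where [1 - s < c], 1/2 where [s <= c <= 1 - s] and 0 elsewhere. If the values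
   1 and 1/2 are taken on sets of measures a and b, then W vanishes outside the
   pairs that are covered, so e <= 1 - (1 - a)^2 + b^2. For a given size
   k = a + b / 2 the right-hand side is a strictly convex function of a, hence
   e <= max (4 k^2, 1 - (1 - k)^2), which is the lower bound on k.

   If fcov W attains the bound, nearly optimal covers are nearly extremal in
   this convexity estimate: a or b is close to 0, and W is L1-close to the
   indicator of a square B x B, or 1 - W is L1-close to that of a square Z x Z.
   The functions that are limits in L1 of indicators of squares are themselves
   such indicators, because the square can be read off from the degree
   function. So no compactness argument is needed, although the infimum
   defining fcov is not known beforehand to be attained. *)

Require Import Defs.
From HB Require Import structures.
From mathcomp Require Import all_boot all_order all_algebra.
From mathcomp Require Import all_classical all_reals all_analysis.
From mathcomp Require Import measurable_realfun ess_sup_inf.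
From mathcomp Require Import ring lra.

Set Implicit Arguments.
Unset Strict Implicit.
Unset Printing Implicit Defensive.

Import Order.TTheory GRing.Theory Num.Theory.
Import numFieldNormedType.Exports.

Local Open Scope classical_set_scope.
Local Open Scope ring_scope.

(** * Real inequalities: the two terms of the minimum, the convexity estimate, counting
    thresholds *)

Section Arithmetic.
Variable R : realType.
Implicit Types a b e q s m t : R.

(** With [s = sqrt (1 - e)] one has [e = (1 - s) * (1 + s)], so [(1 - s)^2 <= e / 4] follows from
    [4 * (1 - s) <= 1 + s], that is [3 / 5 <= s], that is [e <= 0.64]. *)
Lemma min_sqrt_small e : 0 <= e -> e <= 64 / 100 ->
  Num.min (Num.sqrt (1 / 4 * e)) (1 - Num.sqrt (1 - e)) = 1 - Num.sqrt (1 - e).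
Proof.
move=> e0 e64; apply/min_idPr.
have e1 : 0 <= 1 - e by lra.
have := sqr_sqrtr e1; set s := Num.sqrt (1 - e) => ss.
have s0 : 0 <= s by exact: sqrtr_ge0.
have s1 : s <= 1 by nra.
have s35 : 3 / 5 <= s by nra.
rewrite -(@ger0_norm _ (1 - s)); last by lra.
by rewrite -sqrtr_sqr ler_wsqrtr//; nra.
Qed.

Lemma min_sqrt_large e : e <= 1 -> 64 / 100 <= e ->
  Num.min (Num.sqrt (1 / 4 * e)) (1 - Num.sqrt (1 - e)) = Num.sqrt (1 / 4 * e).
Proof.
move=> e1 e64; apply/min_idPl.
have e1' : 0 <= 1 - e by lra.
have := sqr_sqrtr e1'; set s := Num.sqrt (1 - e) => ss.
have s0 : 0 <= s by exact: sqrtr_ge0.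
have s1 : s <= 1 by nra.
have s35 : s <= 3 / 5 by nra.
rewrite -(@ger0_norm _ (1 - s)); last by lra.
by rewrite -sqrtr_sqr ler_wsqrtr//; nra.
Qed.

Lemma sqrt_quarter e : Num.sqrt (1 / 4 * e) = Num.sqrt e / 2.
Proof.
rewrite (_ : 1 / 4 * e = 2^-1 ^+ 2 * e); last by field.
by rewrite sqrtrM ?sqr_ge0// sqrtr_sqr ger0_norm ?invr_ge0// mulrC.
Qed.

(* The weight [1 - (1 - a)^2 + b^2] is strictly convex along [a + b / 2 = t];
   the last term of the bound measures the distance to the chord between its
   values [2t - t^2] at [b = 0] and [4t^2] at [a = 0]. *)
Lemma weight_chord a b m : 0 <= a -> 0 <= b ->
  4 * (a + b / 2) ^+ 2 <= m -> 2 * (a + b / 2) - (a + b / 2) ^+ 2 <= m ->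
  1 - (1 - a) ^+ 2 + b ^+ 2 <= m - 3 * a * (b / 2).
Proof.
move=> a0 b0 h1 h2; set t := a + b / 2 in h1 h2.
have [t0|t0] := eqVneq t 0.
  have -> : a = 0 by rewrite /t in t0; lra.
  have -> : b = 0 by rewrite /t in t0; lra.
  by rewrite t0 in h1; lra.
have tgt0 : 0 < t by rewrite lt_neqAle eq_sym t0 /t/=; lra.
rewrite -(ler_pM2l tgt0).
have -> : t * (1 - (1 - a) ^+ 2 + b ^+ 2) =
    a * (2 * t - t ^+ 2) + b / 2 * (4 * t ^+ 2) - t * (3 * a * (b / 2)).
  by rewrite /t; field.
have ha := ler_wpM2l a0 h2.
have b20 : 0 <= b / 2 by lra.
have hb := ler_wpM2l b20 h1.
have tm : t * m = a * m + b / 2 * m by rewrite /t; ring.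
by rewrite (mulrBr t m) tm lerD2r lerD.
Qed.

(** Squaring [2 * m <= sqrt e] and [sqrt (1 - e) <= 1 - m] shows that at size [m] both ends of the
    chord in [weight_chord] are at most [e]. *)
Lemma min_sqrt_bounds e (m := Num.min (Num.sqrt (1 / 4 * e)) (1 - Num.sqrt (1 - e))) :
  0 <= e <= 1 ->
  [/\ 0 <= m <= 2^-1, 4 * m ^+ 2 <= e & 2 * m - m ^+ 2 <= e].
Proof.
move=> /andP[e0 e1]; have e1' : 0 <= 1 - e by lra.
have m1 : m <= Num.sqrt (1 / 4 * e) by rewrite ge_min lexx.
have m2 : m <= 1 - Num.sqrt (1 - e) by rewrite ge_min lexx orbT.
move: m1 m2; rewrite sqrt_quarter.
have s0 := sqrtr_ge0 (1 - e); have q0 := sqrtr_ge0 e.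
have ss := sqr_sqrtr e1'; have qq := sqr_sqrtr e0.
have m0 : 0 <= m.
  rewrite /m le_min sqrtr_ge0 subr_ge0/=.
  by rewrite -[leRHS]sqrtr1 ler_wsqrtr//; lra.
set q := Num.sqrt e in q0 qq *; set s := Num.sqrt (1 - e) in s0 ss *.
move=> m1 m2; have q1 : q <= 1 by nra.
split; first by rewrite m0/=; lra.
  have : (2 * m) ^+ 2 <= q ^+ 2 by rewrite ler_sqr ?nnegrE//; lra.
  by rewrite qq exprMn; lra.
have : s ^+ 2 <= (1 - m) ^+ 2 by rewrite ler_sqr ?nnegrE//; lra.
by rewrite ss; lra.
Qed.

(** If the size were below both terms of the minimum, both ends of the chord would lie strictly
    below [e], and by convexity so would the weight. *)
Lemma weight_bound e a b : 0 <= e <= 1 -> 0 <= a -> 0 <= b ->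
  e <= 1 - (1 - a) ^+ 2 + b ^+ 2 ->
  Num.min (Num.sqrt (1 / 4 * e)) (1 - Num.sqrt (1 - e)) <= a + b / 2.
Proof.
move=> /andP[e0 e1] a0 b0 eh; have e1' : 0 <= 1 - e by lra.
rewrite leNgt; apply/negP; rewrite lt_min sqrt_quarter => /andP[].
have s0 := sqrtr_ge0 (1 - e); have q0 := sqrtr_ge0 e.
have ss := sqr_sqrtr e1'; have qq := sqr_sqrtr e0.
set q := Num.sqrt e in q0 qq *; set s := Num.sqrt (1 - e) in s0 ss *.
set t := a + b / 2 => tq ts.
have t0 : 0 <= t by rewrite /t; lra.
have h1 : 4 * t ^+ 2 < e.
  have : (2 * t) ^+ 2 < q ^+ 2 by rewrite ltr_sqr ?nnegrE//; lra.
  by rewrite qq exprMn; lra.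
have h2 : 2 * t - t ^+ 2 < e.
  have : s ^+ 2 < (1 - t) ^+ 2 by rewrite ltr_sqr ?nnegrE//; lra.
  by rewrite ss; lra.
pose M := Num.max (4 * t ^+ 2) (2 * t - t ^+ 2).
have Me : M < e by rewrite gt_max h1 h2.
have := @weight_chord a b M a0 b0; rewrite -/t !le_max !lexx orbT => /(_ isT isT).
have : 0 <= a * (b / 2) by apply: mulr_ge0 => //; lra.
lra.
Qed.

(** Raising the size from [m] to [m + t] raises the chord ends by at most [8 * t], because
    [m <= 1/2] and [t <= 1]. The term [3 * a * (b / 2)] is kept: it later forces [a * b] to be
    small. *)
Lemma weight_stability e a b t
    (m := Num.min (Num.sqrt (1 / 4 * e)) (1 - Num.sqrt (1 - e))) :
  0 <= e <= 1 -> 0 <= a -> 0 <= b -> 0 <= t <= 1 -> a + b / 2 <= m + t ->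
  1 - (1 - a) ^+ 2 + b ^+ 2 <= e + 8 * t - 3 * a * (b / 2).
Proof.
move=> e01 a0 b0 /andP[t0 t1] abm.
have [/andP[m0 m12] m4 m2] := @min_sqrt_bounds e e01; rewrite -/m in m0 m12 m4 m2.
apply: weight_chord => //.
  have : (a + b / 2) ^+ 2 <= (m + t) ^+ 2 by rewrite ler_sqr ?nnegrE; lra.
  by nra.
(* The function [2x - x^2] increases only up to 1; beyond that its bound 1 suffices, since then
   [t > 1/2]. *)
have [tm|tm] := leP (m + t) 1.
  have : (1 - (m + t)) ^+ 2 <= (1 - (a + b / 2)) ^+ 2.
    by rewrite ler_sqr ?nnegrE; lra.
  by nra.
by have := sqr_ge0 (1 - (a + b / 2)); nra.
Qed.

Lemma count_threshold_le N t : 0 <= t ->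
  \sum_(i < N) ((i.+1%:R <= t :> R)%:R : R) <= t /\
  \sum_(i < N) ((i.+1%:R <= t :> R)%:R : R) <= N%:R.
Proof.
move=> t0; elim: N => [|N [IH1 IH2]]; first by rewrite big_ord0.
rewrite big_ord_recr/= -[N.+1]addn1 natrD;
  case: (leP (N%:R + 1)) => h /=; rewrite ?mulr1n ?mulr0n; last by lra.
by lra.
Qed.

Lemma count_threshold_gt N t :
  \sum_(i < N) ((t < i.+1%:R :> R)%:R : R) <= Num.max 0 (N%:R + 1 - t).
Proof.
elim: N => [|N IH]; first by rewrite big_ord0 le_max lexx.
rewrite big_ord_recr/= -[N.+1]addn1 natrD; case: ltP => h /=; rewrite ?mulr1n ?mulr0n.
  by move: IH; rewrite !le_max => /orP[]; lra.
by move: IH; rewrite !le_max => /orP[]; lra.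
Qed.

(** Discrete form of the identity that, for [g] in [0, 1], the integral over [s] in [0, 1/2] of the
    indicators of [s <= g] and [1 - s < g] is [g]. Here [s = i / (2N)], [g = t / (2N)], and the
    extra 1 is the discretisation error. *)
Lemma count_thresholds N t : 0 <= t ->
  \sum_(i < N) ((i.+1%:R <= t :> R)%:R + (2 * N%:R - i.+1%:R < t :> R)%:R : R) <= t + 1.
Proof.
move=> t0; rewrite big_split/=; have [h1 h2] := @count_threshold_le N t t0.
under [X in _ + X]eq_bigr => i _ do rewrite ltrBlDr -ltrBlDl.
have := @count_threshold_gt N (2 * N%:R - t); rewrite le_max => /orP[]; lra.
Qed.

End Arithmetic.

(** * Measurability of superlevel sets *)

Section RealLevelSets.
Context d (T : measurableType d) (R : realType).
Variables (f : T -> R) (a : R).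
Hypothesis mf : measurable_fun setT f.

Lemma measurable_superlevel_lt : measurable [set x | a < f x].
Proof.
rewrite -[X in measurable X]setTI.
have := mf measurableT (measurable_itv `]a, +oo[).
by congr (measurable (_ `&` _)); apply/seteqP; split=> x /=; rewrite in_itv/= andbT.
Qed.

Lemma measurable_superlevel_le : measurable [set x | a <= f x].
Proof.
rewrite -[X in measurable X]setTI.
have := mf measurableT (measurable_itv `[a, +oo[).
by congr (measurable (_ `&` _)); apply/seteqP; split=> x /=; rewrite in_itv/= andbT.
Qed.

End RealLevelSets.

(** * Real-valued integrals over a finite measure *)

Section Integral.
Context d (T : measurableType d) (R : realType).
Variable mu : {finite_measure set T -> \bar R}.
Implicit Types f g : T -> R.

Lemma bounded_integrable f M : measurable_fun setT f -> (forall x, `|f x| <= M) ->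
  mu.-integrable setT (EFin \o f).
Proof.
move=> mf fM; apply: measurable_bounded_integrable => //.
  by rewrite -ge0_fin_numE ?measure_ge0// fin_num_measure.
by exists M; split; rewrite ?num_real// => t Mt x _ /=; apply: le_trans (ltW Mt).
Qed.

Lemma integrable_addr f g : mu.-integrable setT (EFin \o f) ->
  mu.-integrable setT (EFin \o g) ->
  mu.-integrable setT (EFin \o (fun x => f x + g x)).
Proof. exact: integrableD. Qed.

Lemma integrable_subr f g : mu.-integrable setT (EFin \o f) ->
  mu.-integrable setT (EFin \o g) ->
  mu.-integrable setT (EFin \o (fun x => f x - g x)).
Proof. exact: integrableB. Qed.

Lemma integrable_scaler (k : R) f : mu.-integrable setT (EFin \o f) ->
  mu.-integrable setT (EFin \o (fun x => k * f x)).
Proof. exact: integrableZl. Qed.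

Lemma integrable_itv01 f : measurable_fun setT f -> (forall x, 0 <= f x <= 1) ->
  mu.-integrable setT (EFin \o f).
Proof.
move=> mf f01; apply: (@bounded_integrable _ 1) => // x.
by case/andP: (f01 x) => ? ?; rewrite ger0_norm.
Qed.

Lemma integrable_indicT (A : set T) : measurable A ->
  mu.-integrable setT (EFin \o (\1_A : T -> R)).
Proof.
move=> mA; apply: (@bounded_integrable _ 1) => //.
by move=> x; rewrite indicE; case: (_ \in _); rewrite ?normr1 ?normr0.
Qed.

Lemma Rintegral_indic (A : set T) : measurable A ->
  \int[mu]_x (\1_A : T -> R) x = fine (mu A).
Proof. by move=> mA; rewrite /Rintegral integral_indic// setIT. Qed.

Lemma ae_eq_Rintegral f g : measurable_fun setT f -> measurable_fun setT g ->
  {ae mu, forall x, f x = g x} -> \int[mu]_x f x = \int[mu]_x g x.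
Proof.
move=> mf mg fg; congr fine; apply: ae_eq_integral => //.
- exact/measurable_EFinP.
- exact/measurable_EFinP.
- by apply: filterS fg => x /= ->.
Qed.

Lemma ae_le_Rintegral f g :
  mu.-integrable setT (EFin \o f) -> mu.-integrable setT (EFin \o g) ->
  {ae mu, forall x, f x <= g x} -> \int[mu]_x f x <= \int[mu]_x g x.
Proof.
move=> intf intg fg; rewrite -subr_ge0 -RintegralB//.
have mf : measurable_fun setT f by apply/measurable_EFinP/(measurable_int mu).
have mg : measurable_fun setT g by apply/measurable_EFinP/(measurable_int mu).
(* The difference is nonnegative only almost everywhere; its absolute value is so everywhere and has
   the same integral. *)
rewrite (@ae_eq_Rintegral _ (fun x => `|g x - f x|)).
- exact: Rintegral_ge0.
- exact: measurable_funB.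
- by apply: measurableT_comp => //; exact: measurable_funB.
- by apply: filterS fg => x fgx; rewrite ger0_norm// subr_ge0.
Qed.

Lemma Rintegral_normr_eq0 f : mu.-integrable setT (EFin \o f) ->
  \int[mu]_x `|f x| <= 0 -> {ae mu, forall x, f x = 0}.
Proof.
move=> intf f0; have mf := measurable_int mu intf.
have /ae_eq_integral_abs : (\int[mu]_x `|(EFin \o f) x| = 0)%E.
  have intn := integrable_norm intf.
  have := integrable_fin_num measurableT intn.
  rewrite /= => /fineK <-; congr EFin; apply/eqP.
  by rewrite eq_le; apply/andP; split => //; exact: Rintegral_ge0.
by move=> /(_ measurableT mf); apply: filterS => x /(_ I)[].
Qed.

Lemma integrable_sumr I (s : seq I) (f : I -> T -> R) :
  (forall i, mu.-integrable setT (EFin \o f i)) ->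
  mu.-integrable setT (EFin \o (fun x => \sum_(i <- s) f i x)).
Proof.
move=> intf; elim: s => [|i s IH].
  rewrite (_ : _ \o _ = cst 0%E); first exact: integrable0.
  by apply/funext => x /=; rewrite big_nil.
rewrite (_ : (fun x => _) = (fun x => f i x + \sum_(j <- s) f j x)).
  exact: integrable_addr.
by apply/funext => x; rewrite big_cons.
Qed.

Lemma Rintegral_sum I (s : seq I) (f : I -> T -> R) :
  (forall i, mu.-integrable setT (EFin \o f i)) ->
  \int[mu]_x (\sum_(i <- s) f i x) = \sum_(i <- s) \int[mu]_x f i x.
Proof.
move=> intf; elim: s => [|i s IH].
  rewrite big_nil (@eq_Rintegral _ _ _ _ _ (fun=> 0)); last by move=> x _; rewrite big_nil.
  by rewrite Rintegral_cst// mul0r.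
rewrite big_cons -IH -RintegralD//; last exact: integrable_sumr.
by apply: eq_Rintegral => x _; rewrite big_cons.
Qed.

End Integral.

(** * The product measure and Tonelli's theorem for bounded functions *)

Section ProductIntegral.
Context d (T : measurableType d) (R : realType) (nu : probability T R).

Let prod := (nu \x nu)%E.
HB.instance Definition _ := Measure.on prod.
Let prod_setT : prod setT = 1%E.
Proof.
rewrite -setXTT [LHS]product_measure1E// -[RHS]mule1.
by congr (_ * _)%E; exact: probability_setT.
Qed.
HB.instance Definition _ := Measure_isProbability.Build _ _ _ prod prod_setT.

(** Carries the probability structure, so that the lemmas on finite measures apply on the square. *)
Definition product_probability : probability (T * T)%type R := prod.

Lemma Rintegral_indicX (A B : set T) : measurable A -> measurable B ->
  \int[product_probability]_z (\1_(A `*` B) : T * T -> R) z = fine (nu A) * fine (nu B).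
Proof.
move=> mA mB; rewrite Rintegral_indic; last exact: measurableX.
by rewrite -fineM ?fin_num_measure//; congr fine; exact: product_measure1E.
Qed.

(** Tonelli's theorem for real integrals: the sections are bounded, hence have finite integrals, and
    [fine] loses nothing. *)
Lemma Rintegral_iterated (f : T * T -> R) M : measurable_fun setT f ->
  (forall z, 0 <= f z <= M) ->
  [/\ measurable_fun setT (fun x => \int[nu]_y f (x, y)),
      forall x, 0 <= \int[nu]_y f (x, y) <= M
    & \int[nu]_x \int[nu]_y f (x, y) = \int[product_probability]_z f z].
Proof.
move=> mf fM.
have mEf : measurable_fun setT (EFin \o f) by exact/measurable_EFinP.
have Ef0 z : (0 <= (EFin \o f) z)%E by rewrite /= lee_fin; case/andP: (fM z).
have msec x : measurable_fun setT (fun y => f (x, y)).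
  by apply: (measurableT_comp mf); exact: measurable_pair1.
have isec x : nu.-integrable setT (EFin \o (fun y => f (x, y))).
  apply: (@bounded_integrable _ _ _ _ _ M) => // y.
  by case/andP: (fM (x, y)) => f0 fM'; rewrite ger0_norm.
have sec x : (\int[nu]_y (EFin \o f) (x, y))%E = (\int[nu]_y f (x, y))%:E.
  by rewrite /Rintegral fineK//; exact: (integrable_fin_num measurableT (isec x)).
have sec' : fubini_F nu (EFin \o f) = EFin \o (fun x => \int[nu]_y f (x, y)).
  by apply/funext => x; rewrite /fubini_F sec.
split.
- by apply/measurable_EFinP; rewrite -sec'; exact: measurable_fun_fubini_tonelli_F.
- move=> x; apply/andP; split.
    by apply: Rintegral_ge0 => y _; case/andP: (fM (x, y)).
  rewrite [leRHS](_ : _ = \int[nu]_y cst M y).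
    apply: le_Rintegral => //.
      apply: (@bounded_integrable _ _ _ _ _ `|M|) => //.
    by move=> y _; case/andP: (fM (x, y)).
  by rewrite Rintegral_cst// [fine _](congr1 fine (probability_setT nu)) mulr1.
- by rewrite [RHS]/Rintegral (@fubini_tonelli1 _ _ _ _ _ nu nu (EFin \o f) mEf Ef0) sec'.
Qed.

End ProductIntegral.

(** * L1-limits of indicators of squares *)

Section SquareLimit.
Context d (T : measurableType d) (R : realType) (nu : probability T R).
Let prod := product_probability nu.
Implicit Types U : T * T -> R.

Lemma indic_ge0_le1 S (A : set S) x : 0 <= (\1_A x : R) <= 1.
Proof. by rewrite indicE; case: (_ \in _); rewrite lexx ler01. Qed.

Lemma indicX S1 S2 (A : set S1) (B : set S2) x y :
  \1_(A `*` B) (x, y) = \1_A x * \1_B y :> R.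
Proof.
rewrite !indicE in_setX/=.
by do 2 case: (_ \in _); rewrite /= ?mulr1n ?mulr0n; ring.
Qed.

Lemma integrable_normB_indic U (A : set (T * T)) :
  measurable_fun setT U -> (forall z, 0 <= U z <= 1) -> measurable A ->
  prod.-integrable setT (EFin \o (fun z => `|U z - \1_A z|)).
Proof.
move=> mU U01 mA; apply: (@bounded_integrable _ _ _ _ _ 1).
  by apply: measurableT_comp => //; exact: measurable_funB.
move=> z; rewrite normr_id; have /andP[? ?] := U01 z.
have /andP[? ?] := @indic_ge0_le1 _ A z.
by rewrite ler_norml; apply/andP; split; lra.
Qed.

(* [B] is recovered from [U] as the set of points whose degree exceeds half of
   [sqrt (\int U)], up to an error controlled by the L1 distance. *)
Lemma square_symdiff U (B : set T) (k t : R)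
    (C := [set x | k / 2 < \int[nu]_y U (x, y)]) :
  measurable_fun setT U -> (forall z, 0 <= U z <= 1) -> measurable B ->
  0 < k -> k ^+ 2 = \int[prod]_z U z -> t <= 7 / 16 * k ^+ 2 ->
  \int[prod]_z `|U z - \1_(B `*` B) z| <= t ->
  \int[prod]_z `|U z - \1_(C `*` C) z| <= (1 + 8 / k) * t.
Proof.
move=> mU U01 mB k0 kU tk UB.
have [mD D01 _] := Rintegral_iterated nu mU U01.
have mC : measurable C by exact: measurable_superlevel_lt.
have iU : prod.-integrable setT (EFin \o U) by exact: integrable_itv01.
have mBB : measurable (B `*` B) by exact: measurableX.
have mCC : measurable (C `*` C) by exact: measurableX.
have iB := integrable_indicT prod mBB.
have b0 : 0 <= fine (nu B) by rewrite fine_ge0.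
(* The integrals give [k^2 - nu(B)^2 <= t], and [7/16 = 1 - (3/4)^2]. *)
have bk : 3 / 4 * k <= fine (nu B).
  have : \int[prod]_z (U z - \1_(B `*` B) z) <= t.
    apply: le_trans UB; apply: le_Rintegral => //.
    - exact: integrable_subr.
    - exact: integrable_normB_indic.
    - by move=> z _; exact: ler_norm.
  rewrite RintegralB// -kU Rintegral_indicX// => h.
  by rewrite leNgt; apply/negP => ?; nra.
pose F z := `|U z - \1_(B `*` B) z|.
have mF : measurable_fun setT F.
  by apply: measurableT_comp => //; exact: measurable_funB.
have F01 z : 0 <= F z <= 1.
  rewrite normr_ge0/=; have /andP[? ?] := U01 z.
  have /andP[? ?] := @indic_ge0_le1 _ (B `*` B) z.
  by rewrite ler_norml; apply/andP; split; lra.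
have [mG G01 GE] := Rintegral_iterated nu mF F01.
pose E := (C `\` B) `|` (B `\` C).
have mE : measurable E by apply: measurableU; exact: measurableD.
(* Markov's inequality, pointwise: [U] and the square have degrees differing by at least [k / 4] on
   [E]. On [C] minus [B] they are above [k / 2] and equal to 0; on [B] minus [C] they are at most
   [k / 2] and at least [3k / 4]. *)
have EG x : \1_E x <= 4 / k * \int[nu]_y F (x, y).
  have isec : nu.-integrable setT (EFin \o (fun y => U (x, y))).
    apply: integrable_itv01 => //.
    by apply: (measurableT_comp mU); exact: measurable_pair1.
  have isecB : nu.-integrable setT (EFin \o (fun y => \1_B x * \1_B y : R)).
    apply: (@bounded_integrable _ _ _ _ _ 1).
      by apply: measurable_funM => //; exact: measurable_cst.
    move=> y; have /andP[? ?] := @indic_ge0_le1 _ B x.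
    have /andP[? ?] := @indic_ge0_le1 _ B y.
    by rewrite normrM !ger0_norm//; nra.
  have /= : `|\int[nu]_y (U (x, y) - \1_B x * \1_B y)| <= \int[nu]_y F (x, y).
    have := le_normr_Rintegral measurableT (integrable_subr isec isecB).
    by congr (_ <= _); apply: eq_Rintegral => y _; rewrite /F indicX.
  rewrite RintegralB// RintegralZl//; last exact: integrable_indicT.
  rewrite Rintegral_indic// => le_G.
  have G0 : 0 <= \int[nu]_y F (x, y) by case/andP: (G01 x).
  rewrite ler_norml in le_G.
  case/andP: le_G; rewrite !indicE; set Dx := \int[nu]_y U (x, y) => l1 l2.
  have kinv : 1 = 4 / k * (k / 4) by field; rewrite gt_eqF.
  have k4 : 0 <= 4 / k by rewrite divr_ge0// ltW.
  have [xE|] := boolP (x \in E); last by rewrite mulr_ge0.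
  rewrite /= mulr1n [leLHS]kinv ler_wpM2l//.
  move: xE; rewrite inE => -[[xC xB]|[xB xC]].
    by rewrite (memNset xB) /= in l1 l2; rewrite /C/= -/Dx in xC; lra.
  move/negP: xC; rewrite -leNgt -/Dx => xC.
  by rewrite (mem_set xB) /= in l1 l2; lra.
have nuE : fine (nu E) <= 4 / k * t.
  rewrite -Rintegral_indic//.
  have iG : nu.-integrable setT (EFin \o (fun x => \int[nu]_y F (x, y))).
    exact: integrable_itv01.
  apply: (@le_trans _ _ (\int[nu]_x (4 / k * \int[nu]_y F (x, y)))).
    apply: le_Rintegral => //; first exact: integrable_indicT.
    exact: integrable_scaler.
  by rewrite RintegralZl// GE ler_wpM2l// divr_ge0// ltW.
(* The squares of [B] and [C] differ only at pairs with a coordinate in [E], so [H] dominates their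
   difference and has integral [2 * nu(E) <= 8 * t / k]. *)
pose H z := (\1_(E `*` setT) z + \1_(setT `*` E) z : R).
have mET : measurable (E `*` [set: T]) by exact: measurableX.
have mTE : measurable ([set: T] `*` E) by exact: measurableX.
have iF : prod.-integrable setT (EFin \o F) by exact: integrable_normB_indic.
have iH : prod.-integrable setT (EFin \o H).
  by apply: integrable_addr => //; exact: integrable_indicT.
apply: (@le_trans _ _ (\int[prod]_z (F z + H z))).
  apply: le_Rintegral => //.
  - exact: integrable_normB_indic.
  - exact: integrable_addr.
  move=> [x y] _; rewrite /F /H !indicX.
  set u := U (x, y).
  apply: le_trans (ler_distD (\1_B x * \1_B y) _ _) _; rewrite lerD2l.
  rewrite !indicE /E !in_setU !in_setD !in_setT.
  by case: (x \in B); case: (y \in B); case: (x \in C); case: (y \in C);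
    rewrite /= ?mulr1n ?mulr0n ?mulr0 ?mulr1 ?subrr ?subr0 ?sub0r ?normrN ?normr0 ?normr1; lra.
rewrite RintegralD// /H RintegralD//; [|exact: integrable_indicT..].
rewrite !Rintegral_indicX//.
have -> : fine (nu setT) = 1 by rewrite [fine _](congr1 fine (probability_setT nu)).
by rewrite mulr1 mul1r; move: UB; rewrite -/F; lra.
Qed.

(** The set [C] of [square_symdiff] depends on [U] alone and not on the approximating square, so the
    distance from [U] to the square of [C] is below every positive number. A null [U] is treated
    apart because [k] must be positive. *)
Lemma square_limit U : measurable_fun setT U -> (forall z, 0 <= U z <= 1) ->
  (forall t : R, 0 < t -> exists2 B, measurable B &
    \int[prod]_z `|U z - \1_(B `*` B) z| <= t) ->
  exists2 C, measurable C & {ae prod, forall z, U z = \1_(C `*` C) z}.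
Proof.
move=> mU U01 Ulim.
have iU : prod.-integrable setT (EFin \o U) by exact: integrable_itv01.
have U0 : 0 <= \int[prod]_z U z by apply: Rintegral_ge0 => z _; case/andP: (U01 z).
have [uz|uz] := eqVneq (\int[prod]_z U z) 0.
  exists set0 => //.
  have : \int[prod]_z `|U z| <= 0.
    rewrite -[leRHS]uz le_eqVlt; apply/orP; left; apply/eqP.
    by apply: eq_Rintegral => z _; rewrite ger0_norm//; case/andP: (U01 z).
  move/(Rintegral_normr_eq0 iU); apply: filterS => z ->.
  by rewrite set0X indic0.
pose k := Num.sqrt (\int[prod]_z U z).
have k0 : 0 < k by rewrite sqrtr_gt0 lt_neqAle eq_sym uz.
have kU : k ^+ 2 = \int[prod]_z U z by rewrite sqr_sqrtr.
have [mD _ _] := Rintegral_iterated nu mU U01.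
pose C := [set x | k / 2 < \int[nu]_y U (x, y)].
have mC : measurable C by exact: measurable_superlevel_lt.
have mCC : measurable (C `*` C) by exact: measurableX.
exists C => //.
have k8 : 0 < 1 + 8 / k by rewrite addr_gt0// divr_gt0.
have : \int[prod]_z `|U z - \1_(C `*` C) z| <= 0.
  apply/ler_addgt0Pr => t t0; rewrite add0r.
  (* The first entry meets the closeness condition of [square_symdiff], the second absorbs its
     factor [1 + 8 / k]. *)
  pose t' := Num.min (7 / 16 * k ^+ 2) (t / (1 + 8 / k)).
  have t'0 : 0 < t' by rewrite lt_min divr_gt0// mulr_gt0// exprn_gt0.
  have [B mB UB] := Ulim t' t'0.
  apply: le_trans (square_symdiff mU U01 mB k0 kU _ UB) _.
    by rewrite ge_min lexx.
  by rewrite mulrC -ler_pdivlMr// ge_min lexx orbT.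
have := integrable_subr iU (integrable_indicT prod mCC).
move=> /Rintegral_normr_eq0 /[apply].
by apply: filterS => z /eqP; rewrite subr_eq0 => /eqP.
Qed.

End SquareLimit.

(** * Rounding a fractional cover to values 0, 1/2, 1 *)

Section Threshold.
Context d (T : measurableType d) (R : realType) (nu : probability T R).
Let prod := product_probability nu.

Lemma mem_set_bool S (P : pred S) x : (x \in [set y | P y]) = P x.
Proof. by apply/idP/idP; rewrite inE. Qed.

(** Averaging over the [N] thresholds [i / (2N)]: by [count_thresholds] the mean of the left-hand
    side is at most [2 * \int g + 1 / N], and [1 / N <= t], so some threshold does as well. *)
Lemma good_threshold (g : T -> R) (t : R) : measurable_fun setT g ->
  (forall x, 0 <= g x <= 1) -> 0 < t ->
  exists2 s : R, 0 < s <= 2^-1 &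
    fine (nu [set x | s <= g x]) + fine (nu [set x | 1 - s < g x]) <=
      2 * (\int[nu]_x g x + t).
Proof.
move=> mg g01 t0; pose N := (Num.bound t^-1).+1.
have N0 : 0 < N%:R :> R by rewrite ltr0n.
have Nt : 1 <= N%:R * t.
  rewrite -ler_pdivrMr// mul1r (le_trans (ltW (archi_boundP _)))//.
    by rewrite invr_ge0 ltW.
  by rewrite ler_nat.
have intg : nu.-integrable setT (EFin \o g) by exact: integrable_itv01.
pose s (i : 'I_N) : R := i.+1%:R / (2 * N%:R).
have s_bnd i : 0 < s i <= 2^-1.
  rewrite divr_gt0 ?ltr0n// ?mulr_gt0//= ler_pdivrMr ?mulr_gt0//.
  by rewrite mulrA mulVf// mul1r ler_nat.
pose h i x : R := \1_[set x | s i <= g x] x + \1_[set x | 1 - s i < g x] x.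
have mle r := measurable_superlevel_le r mg.
have mlt r := measurable_superlevel_lt r mg.
have inth i : nu.-integrable setT (EFin \o h i).
  by apply: integrable_addr; exact: integrable_indicT.
have hE i : \int[nu]_x h i x =
    fine (nu [set x | s i <= g x]) + fine (nu [set x | 1 - s i < g x]).
  by rewrite RintegralD ?Rintegral_indic//; exact: integrable_indicT.
have sumh : \sum_(i < N) \int[nu]_x h i x <= 2 * N%:R * \int[nu]_x g x + 1.
  rewrite -Rintegral_sum//.
  have -> : 2 * N%:R * \int[nu]_x g x + 1 = \int[nu]_x (2 * N%:R * g x + 1).
    rewrite RintegralD ?RintegralZl//; last 2 first.
    - exact: integrable_scaler.
    - by apply: integrable_itv01 => // x; rewrite ler01 lexx.
    by rewrite Rintegral_cst// [fine _](congr1 fine (probability_setT nu)) mulr1.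
  apply: le_Rintegral => //.
  - exact: integrable_sumr.
  - apply: integrable_addr; first exact: integrable_scaler.
    by apply: integrable_itv01 => // x; rewrite ler01 lexx.
  move=> x _; have /andP[gx0 gx1] := g01 x.
  have n0 : 0 <= 2 * N%:R * g x by rewrite !mulr_ge0.
  apply: le_trans (count_thresholds N n0); rewrite le_eqVlt; apply/orP; left; apply/eqP.
  apply: eq_bigr => i _; rewrite /h !indicE (mem_set_bool (fun x => s i <= g x)).
  rewrite (mem_set_bool (fun x => 1 - s i < g x)) /s.
  rewrite ler_pdivrMr ?mulr_gt0// (mulrC (g x)); congr (_ + (nat_of_bool _)%:R).
  by rewrite ltrBlDr -ltrBlDl ltr_pdivlMr ?mulr_gt0// mulrBl mul1r (mulrC (g x)) ltrBlDr -ltrBlDl.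
apply: contrapT => hs.
have : \sum_(i < N) (2 * (\int[nu]_x g x + t)) <= \sum_(i < N) \int[nu]_x h i x.
  apply: ler_sum => i _; rewrite hE leNgt; apply/negP => /ltW hi; apply: hs.
  by exists (s i).
by rewrite sumr_const card_ord -mulr_natr; lra.
Qed.

(** A pair outside [A] in both coordinates and not in [B x B] has one value below [s] and the other
    at most [1 - s]. It is therefore uncovered and [W] vanishes there almost everywhere; at all
    other pairs the bound equals 1. *)
Lemma half_integral_cover (W : T * T -> R) c t : graphon W ->
  fractional_vertex_cover nu W c -> 0 < t ->
  exists A B : set T, [/\ measurable A, measurable B, A `&` B = set0,
    fine (nu A) + fine (nu B) / 2 <= cover_size nu c + t &
    {ae prod, forall z, W z <= 1 - \1_(~` A `*` ~` A) z + \1_(B `*` B) z}].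
Proof.
move=> [mW _ W01] [cL c01 cW] t0.
have mc : measurable_fun setT c by have := sub_Lfun_mfun cL; rewrite inE.
(* The cover lies in [0, 1] only almost everywhere; truncation makes this hold everywhere without
   changing the size. *)
pose g x := Num.min 1 (Num.max 0 (c x)).
have mg : measurable_fun setT g.
  by apply: measurable_minr => //; exact: measurable_maxr.
have g01 x : 0 <= g x <= 1.
  by rewrite /g le_min ler01 le_max lexx ge_min lexx.
(* Truncation lowers [c] only to the value 1, which covers every pair by itself, so pairs covered by
   [c] stay covered by [g]. *)
have gc x : c x <= g x \/ g x = 1.
  rewrite /g; case: (leP 1 (Num.max 0 (c x))) => _; first by right.
  by left; rewrite le_max lexx orbT.
have cg : cover_size nu c = \int[nu]_x g x.
  apply: ae_eq_Rintegral => //; apply: filterS c01 => x /andP[cx0 cx1].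
  by rewrite /g (max_idPr cx0) (min_idPr cx1).
have [s /andP[s0 s2] sg] := good_threshold mg g01 t0.
pose G := [set x | s <= g x]; pose A := [set x | 1 - s < g x].
have mG : measurable G by exact: measurable_superlevel_le.
have mA : measurable A by exact: measurable_superlevel_lt.
have AG : A `<=` G by move=> x; rewrite /A /G /=; lra.
have mB : measurable (G `\` A) by exact: measurableD.
exists A, (G `\` A); split => //.
- by rewrite setIDA setIC -setIDA setDv setI0.
- have nuG : nu G = (nu A + nu (G `\` A))%E.
    by rewrite -measureU//= ?setDUK// setIDA setIC -setIDA setDv setI0.
  move: sg; rewrite -/G -/A nuG fineD ?fin_num_measure// -cg; lra.
- exists (supp W `\` [set z | 1 <= c z.1 + c z.2]); split => //.
    apply: measurableD; first exact: measurable_superlevel_lt.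
    apply: measurable_superlevel_le; apply: measurable_funD.
      exact: measurableT_comp.
    exact: measurableT_comp.
  move=> [x y] /= /negP; rewrite -ltNge => Wxy.
  have W1 := W01 (x, y).
  have ind1 := @indic_ge0_le1 R _ (~` A `*` ~` A) (x, y).
  have ind2 := @indic_ge0_le1 R _ ((G `\` A) `*` (G `\` A)) (x, y).
  split; first by rewrite /supp/=; lra.
  move=> cc.
  have gg : 1 <= g x + g y.
    have /andP[? ?] := g01 x; have /andP[? ?] := g01 y.
    by case: (gc x) => ?; case: (gc y) => ?; lra.
  move: Wxy; apply/negP; rewrite -leNgt; move: gg W1.
  rewrite !indicX !indicE !in_setD !in_setC.
  rewrite !(mem_set_bool (fun x => s <= g x)) !(mem_set_bool (fun x => 1 - s < g x)).
  case: (leP s (g x)) => ?; case: (leP s (g y)) => ?;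
  case: (ltP (1 - s) (g x)) => ?; case: (ltP (1 - s) (g y)) => ? /=;
    rewrite ?mulr1n ?mulr0n ?mulr0 ?mulr1; lra.
Qed.
End Threshold.

(** * The lower bound on covers and the structure of extremal graphons *)

Section Extremal.
Context d (T : measurableType d) (R : realType) (nu : probability T R).
Variable W : T * T -> R.
Hypothesis hW : graphon W.
Let prod := product_probability nu.
Let e := \int[prod]_z W z.
Let m := Num.min (Num.sqrt (1 / 4 * e)) (1 - Num.sqrt (1 - e)).

Lemma bounded_Lfun_oo (f : T -> R) M : measurable_fun setT f ->
  (forall x, `|f x| <= M) -> f \in Lfun nu +oo%E.
Proof.
move=> mf fM; rewrite inE; apply/andP; split; rewrite inE//=.
rewrite /finite_norm unlock; case: ifP => // _.
apply: (@le_lt_trans _ _ M%:E); last exact: ltry.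
by apply/ess_supP; apply: aeW => x /=; rewrite lee_fin.
Qed.

Let integrableW : prod.-integrable setT (EFin \o W).
Proof. by apply: integrable_itv01; [exact: graphon_measurable | exact: graphon_range]. Qed.

Let integrable1 (r : R) : prod.-integrable setT (EFin \o (fun=> r)).
Proof. by apply: (@bounded_integrable _ _ _ _ _ `|r|) => //; exact: measurable_cst. Qed.

Let Rintegral1 (r : R) : \int[prod]_z r = r.
Proof. by rewrite Rintegral_cst// [fine _](congr1 fine (probability_setT prod)) mulr1. Qed.

Lemma edge_density01 : 0 <= e <= 1.
Proof.
have W01 := graphon_range hW.
apply/andP; split; first by apply: Rintegral_ge0 => z _; case/andP: (W01 z).
rewrite -[leRHS]Rintegral1; apply: le_Rintegral => // z _.
by case/andP: (W01 z).
Qed.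

(** * Graphons covered by 1 on [A] and 1/2 on [B] *)

Section Weight.
Variables A B : set T.
Hypotheses (mA : measurable A) (mB : measurable B) (AB0 : A `&` B = set0).
(** For disjoint [A] and [B] this is the indicator of the covered pairs. *)
Let sigma z : R := 1 - \1_(~` A `*` ~` A) z + \1_(B `*` B) z.
Hypothesis W_sigma : {ae prod, forall z, W z <= sigma z}.
Let a := fine (nu A).
Let b := fine (nu B).

Let mAC : measurable (~` A). Proof. exact: measurableC. Qed.
Let mAA : measurable (~` A `*` ~` A). Proof. exact: measurableX. Qed.
Let mBB : measurable (B `*` B). Proof. exact: measurableX. Qed.
Let iA := integrable_indicT prod mAA.
Let iB := integrable_indicT prod mBB.
Let isigma : prod.-integrable setT (EFin \o sigma).
Proof. by apply: integrable_addr => //; exact: integrable_subr. Qed.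

Let measure_setC1 (S : set T) : measurable S -> fine (nu (~` S)) = 1 - fine (nu S).
Proof.
by move=> mS; rewrite probability_setC// fineB// fin_num_measure.
Qed.

Let Rintegral_sigma : \int[prod]_z sigma z = 1 - (1 - a) ^+ 2 + b ^+ 2.
Proof.
rewrite RintegralD ?RintegralB// ?Rintegral1; last exact: integrable_subr.
by rewrite !Rintegral_indicX// measure_setC1// !expr2.
Qed.

Lemma edge_density_le_weight : e <= 1 - (1 - a) ^+ 2 + b ^+ 2.
Proof. by rewrite -Rintegral_sigma; exact: ae_le_Rintegral. Qed.

(** Triangle inequality through [sigma]: both [sigma - W] and [sigma] minus the square of [B] are
    nonnegative, and the latter has integral [1 - (1 - a)^2 <= 2 * a]. *)
Lemma dist_square_le : \int[prod]_z `|W z - \1_(B `*` B) z| <=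
  1 - (1 - a) ^+ 2 + b ^+ 2 - e + 2 * a.
Proof.
have iWB := @integrable_normB_indic _ _ _ nu _ _ (graphon_measurable hW) (graphon_range hW) mBB.
have i1 : prod.-integrable setT (EFin \o (fun z => sigma z - W z)).
  by exact: integrable_subr.
have i2 : prod.-integrable setT (EFin \o (fun z => 1 - \1_(~` A `*` ~` A) z)).
  exact: integrable_subr.
apply: (@le_trans _ _ (\int[prod]_z ((sigma z - W z) + (1 - \1_(~` A `*` ~` A) z)))).
  apply: ae_le_Rintegral => //; first exact: integrable_addr.
  apply: filterS W_sigma => z; rewrite /sigma => Wz.
  have /andP[? ?] := @indic_ge0_le1 R _ (~` A `*` ~` A) z.
  by rewrite ler_norml; apply/andP; split; lra.
rewrite RintegralD// !RintegralB// Rintegral_sigma Rintegral1 Rintegral_indicX//.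
by rewrite measure_setC1// -/a -/e; nra.
Qed.

Let Z := ~` (A `|` B).

(** Again through [sigma]: the squares of [B] and [Z] are disjoint inside that of the complement of
    [A], and what they leave over has measure [2 * b * (1 - a - b) <= 2 * b]. *)
Lemma dist_cosquare_le : \int[prod]_z `|(1 - W z) - \1_(Z `*` Z) z| <=
  1 - (1 - a) ^+ 2 + b ^+ 2 - e + 2 * b.
Proof.
have mZ : measurable Z by apply: measurableC; exact: measurableU.
have mZZ : measurable (Z `*` Z) by exact: measurableX.
have nuZ : fine (nu Z) = 1 - (a + b).
  rewrite measure_setC1; last exact: measurableU.
  by rewrite measureU// fineD// fin_num_measure.
have m1W : measurable_fun setT (fun z => 1 - W z).
  by apply: measurable_funB => //; exact: graphon_measurable.
have W01' z : 0 <= 1 - W z <= 1 by have := graphon_range hW z; lra.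
have iWZ := @integrable_normB_indic _ _ _ nu _ _ m1W W01' mZZ.
have iZ := integrable_indicT prod mZZ.
have i1 : prod.-integrable setT (EFin \o (fun z => sigma z - W z)).
  by exact: integrable_subr.
have i2 : prod.-integrable setT (EFin \o (fun z =>
    \1_(~` A `*` ~` A) z - \1_(B `*` B) z - \1_(Z `*` Z) z)).
  by apply: integrable_subr => //; exact: integrable_subr.
apply: (@le_trans _ _ (\int[prod]_z ((sigma z - W z) +
    (\1_(~` A `*` ~` A) z - \1_(B `*` B) z - \1_(Z `*` Z) z)))).
  apply: ae_le_Rintegral => //; first exact: integrable_addr.
  apply: filterS W_sigma => z; rewrite /sigma => Wz.
  have : 0 <= \1_(~` A `*` ~` A) z - \1_(B `*` B) z - \1_(Z `*` Z) z :> R.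
    case: z {Wz} => x y; rewrite !indicX !indicE !in_setC !in_setU.
    have AB u : (u \in A) && (u \in B) = false by rewrite -in_setI AB0 in_set0.
    have := AB x; have := AB y.
    case: (x \in A); case: (y \in A); case: (x \in B); case: (y \in B) => //= _ _;
      rewrite ?mulr1n ?mulr0n; lra.
  by move=> ?; rewrite ler_norml; apply/andP; split; lra.
rewrite RintegralD// !RintegralB//; last exact: integrable_subr.
rewrite Rintegral_sigma !Rintegral_indicX//.
rewrite measure_setC1// nuZ -/a -/b -/e.
have : 0 <= b * (a + b) by rewrite mulr_ge0 ?addr_ge0 ?fine_ge0.
by rewrite -!expr2; lra.
Qed.

End Weight.

Lemma cover_size_ge c : fractional_vertex_cover nu W c -> m <= cover_size nu c.
Proof.
move=> hc; apply/ler_addgt0Pr => t t0.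
have [A [B [mA mB AB0 ABt Wle]]] := half_integral_cover hW hc t0.
apply: le_trans ABt; apply: weight_bound.
- exact: edge_density01.
- by rewrite fine_ge0.
- by rewrite fine_ge0.
- exact: edge_density_le_weight Wle.
Qed.

(** Ensures that [inf] in [fcov] is a true infimum and not a default value; the constant 1 is a
    cover. *)
Lemma has_inf_cover_size :
  has_inf [set cover_size nu c | c in fractional_vertex_cover nu W].
Proof.
split; last by exists m => _ [c hc <-]; exact: cover_size_ge.
exists (cover_size nu (fun=> 1)), (fun=> 1) => //; split.
- by apply: (@bounded_Lfun_oo _ 1) => // x; rewrite normr1.
- by apply: aeW => x; rewrite ler01 lexx.
- rewrite (_ : _ `\` _ = set0) ?measure0//.
  by apply/seteqP; split=> z //= -[_]; apply; lra.
Qed.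

Lemma fcov_ge : m <= fcov nu W.
Proof.
by apply: lb_le_inf => [|_ [c hc <-]]; [case: has_inf_cover_size | exact: cover_size_ge].
Qed.

Lemma fcov_le c : fractional_vertex_cover nu W c -> fcov nu W <= cover_size nu c.
Proof.
by move=> hc; apply: ge_inf; [case: has_inf_cover_size | exists c].
Qed.

(** A rounded cover of size at most [m + r] has weight between [e] and [e + 8 * r - 3 * a * b / 2],
    hence [a * b <= 16 / 3 * r], and [a] or [b] is small. The bounds on [e] serve later to locate
    [e] relative to 0.64. *)
Lemma near_extremal (t : R) : fcov nu W = m -> 0 < t -> t <= 1 ->
  (exists2 B, measurable B & \int[prod]_z `|W z - \1_(B `*` B) z| <= t /\
     e <= 4 * m ^+ 2 + t) \/
  (exists2 Z, measurable Z & \int[prod]_z `|(1 - W z) - \1_(Z `*` Z) z| <= t /\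
     e <= 2 * m - m ^+ 2 + t).
Proof.
(* Chosen so that [16 / 3 * r < (t / 4)^2], which excludes that [a] and [b] both exceed [t / 4].
   Half of [r] goes to the choice of the cover, half to its rounding. *)
move=> fm t0 t1; pose r := t ^+ 2 / 100.
have r0 : 0 < r by rewrite divr_gt0// exprn_gt0.
have r1 : r <= t / 100 by rewrite /r; nra.
have r2 : 0 < r / 2 by lra.
have [_ [c hc <-]] := inf_adherent r2 has_inf_cover_size.
rewrite -/(fcov nu W) fm => cr.
have [A [B [mA mB AB0 ABt Wle]]] := half_integral_cover hW hc r2.
have e01 := edge_density01.
have := edge_density_le_weight mA mB Wle.
have := dist_square_le mA mB Wle.
have := dist_cosquare_le mA mB AB0 Wle.
set a := fine (nu A) in ABt *; set b := fine (nu B) in ABt *.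
have a0 : 0 <= a by rewrite fine_ge0.
have b0 : 0 <= b by rewrite fine_ge0.
have abm : a + b / 2 <= m + r by lra.
have r01 : 0 <= r <= 1 by lra.
have stab := weight_stability e01 a0 b0 r01 abm.
have [/andP[m0 m12] m4 m2] := min_sqrt_bounds e01; rewrite -/m in m0 m12 m4 m2.
move=> coZ sqB ew.
have ab0 : 0 <= a * b by rewrite mulr_ge0.
have abr : a * b <= 16 / 3 * r by lra.
have [at4|at4] := leP a (t / 4).
- left; exists B => //; split; first by lra.
  have : (b / 2) ^+ 2 <= (m + r) ^+ 2 by rewrite ler_sqr ?nnegrE; lra.
  by nra.
- have bt4 : b <= t / 4.
    rewrite leNgt; apply/negP => bt.
    have : t / 4 * (t / 4) <= a * b by apply: ler_pM; lra.
    rewrite (_ : r = t * t / 100) in abr; last by rewrite /r expr2.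
    have : 0 < t * t by rewrite mulr_gt0.
    by lra.
  right; exists (~` (A `|` B)).
    by apply: measurableC; exact: measurableU.
  split; first by lra.
  have : (1 - (m + r)) ^+ 2 <= (1 - a) ^+ 2 by rewrite ler_sqr ?nnegrE; lra.
  by nra.
Qed.

(** Either the first alternative of [near_extremal] holds for all [t], or it fails at some [t1],
    hence at all smaller [t], and the second holds for all [t]. In both cases [square_limit] yields
    the exact structure. *)
Lemma extremal_structure : fcov nu W = m ->
  ((exists2 C, measurable C & {ae prod, forall z, W z = \1_(C `*` C) z}) /\
     e <= 4 * m ^+ 2) \/
  ((exists2 Z, measurable Z & {ae prod, forall z, 1 - W z = \1_(Z `*` Z) z}) /\
     e <= 2 * m - m ^+ 2).
Proof.
move=> fm.
pose P t := exists2 B, measurable B & \int[prod]_z `|W z - \1_(B `*` B) z| <= t /\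
     e <= 4 * m ^+ 2 + t.
have m1W : measurable_fun setT (fun z => 1 - W z).
  by apply: measurable_funB => //; exact: graphon_measurable.
have W01' z : 0 <= 1 - W z <= 1 by have := graphon_range hW z; lra.
have [Pall|/existsNP[t1 /not_implyP[t10 Pt1]]] := pselect (forall t, 0 < t -> P t).
  left; split; last first.
    by apply/ler_addgt0Pr => t t0; have [B _ []] := Pall t t0.
  apply: square_limit; [exact: graphon_measurable | exact: graphon_range |].
  by move=> t t0; have [B mB []] := Pall t t0; exists B.
have Q t : 0 < t ->
    exists2 Z, measurable Z & \int[prod]_z `|(1 - W z) - \1_(Z `*` Z) z| <= t /\
     e <= 2 * m - m ^+ 2 + t.
  (* Below [t1] the first alternative is excluded, since it would imply [P t1]. *)
  move=> t0; pose s := Num.min t (Num.min t1 1).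
  have s0 : 0 < s by rewrite !lt_min t0 t10 ltr01.
  have s1 : s <= 1 by rewrite !ge_min lexx !orbT.
  have st : s <= t by rewrite ge_min lexx.
  have st1 : s <= t1 by rewrite !ge_min lexx !orbT.
  have [[B mB [h1 h2]]|[Z mZ [h1 h2]]] := near_extremal fm s0 s1.
    by exfalso; apply: Pt1; exists B => //; split; lra.
  by exists Z => //; split; lra.
right; split; last first.
  by apply/ler_addgt0Pr => t t0; have [B _ []] := Q t t0.
apply: square_limit => //.
by move=> t t0; have [B mB []] := Q t t0; exists B.
Qed.

End Extremal.

(** * Explicit covers for the extremal graphons *)

Section Covers.
Context d (T : measurableType d) (R : realType) (nu : probability T R).
Variable W : T * T -> R.
Hypothesis hW : graphon W.
Let prod := product_probability nu.

(** Applied with [k = 1] on [B1] for [Psi] and with [k = 1/2] on [C1] for [Phi]; these covers attain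
    the bound. *)
Lemma scaled_indic_cover (k : R) (A : set T) (V : T * T -> R) :
  measurable A -> 0 <= k <= 1 -> {ae prod, forall z, W z = V z} ->
  (forall x y, 0 < V (x, y) -> 1 <= k * \1_A x + k * \1_A y) ->
  fractional_vertex_cover nu W (fun x => k * \1_A x) /\
  cover_size nu (fun x => k * \1_A x) = k * fine (nu A).
Proof.
move=> mA k01 WV Vc; have c01 x : 0 <= k * \1_A x <= 1.
  by have := @indic_ge0_le1 R _ A x; nra.
have mc : measurable_fun setT (fun x => k * \1_A x).
  by apply: measurable_funM => //; exact: measurable_cst.
split; last first.
  by rewrite /cover_size RintegralZl ?Rintegral_indic//; exact: integrable_indicT.
split.
- apply: (@bounded_Lfun_oo _ _ _ _ _ 1) => // x.
  by case/andP: (c01 x) => ? ?; rewrite ger0_norm.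
- exact: aeW.
- have mN : measurable (supp W `\` [set z | 1 <= k * \1_A z.1 + k * \1_A z.2]).
    apply: measurableD; first exact: (measurable_superlevel_lt _ (graphon_measurable hW)).
    apply: measurable_superlevel_le; apply: measurable_funD.
      exact: (measurableT_comp mc measurable_fst).
    exact: (measurableT_comp mc measurable_snd).
  apply: (@measure_negligible _ _ _ prod) => //.
  apply: negligibleS WV => -[x y] [/= Wxy nc] WVxy; apply: nc; apply: Vc.
  by rewrite -WVxy.
Qed.

End Covers.

(** * The bound, the switch at 0.64 and the equality case *)

Theorem theorem19 (R : realType) (d : measure_display) (T : measurableType d)
    (nu : probability T R) (W : T * T -> R) (e : R)
    (hborel : standard_borel R T)
    (hatomless : atomless nu)
    (hW : graphon W)
    (he : e = \int[(nu \x nu)%E]_z W z) :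
  [/\ Num.min (Num.sqrt (1 / 4 * e)) (1 - Num.sqrt (1 - e)) <= fcov nu W,
      e <= 64 / 100 ->
        Num.min (Num.sqrt (1 / 4 * e)) (1 - Num.sqrt (1 - e))
          = 1 - Num.sqrt (1 - e),
      64 / 100 <= e ->
        Num.min (Num.sqrt (1 / 4 * e)) (1 - Num.sqrt (1 - e))
          = Num.sqrt (1 / 4 * e)
    & fcov nu W = Num.min (Num.sqrt (1 / 4 * e)) (1 - Num.sqrt (1 - e)) <->
        (e <= 64 / 100 /\ isomorphic_to_Psi nu e W) \/
        (64 / 100 <= e /\ isomorphic_to_Phi nu e W)].
Proof.
have := edge_density01 nu hW; rewrite -he => e01; have /andP[e0 e1] := e01.
have := fcov_ge nu hW; rewrite -he => lower.
split => //; [exact: min_sqrt_small | exact: min_sqrt_large |].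
have e1' : 0 <= 1 - e by lra.
have s0 := sqrtr_ge0 (1 - e); have q0 := sqrtr_ge0 e.
have ss := sqr_sqrtr e1'; have qq := sqr_sqrtr e0.
split; last first.
  move=> [[e64 [B1 [B2 [[mB1 mB2 B0 BT] nuB1 nuB2 WPsi]]]]|
          [e64 [C1 [C2 [[mC1 mC2 C0 CT] nuC1 nuC2 WPhi]]]]];
    apply/eqP; rewrite eq_le lower andbT.
  - rewrite min_sqrt_small//.
    have [] := @scaled_indic_cover _ _ _ nu W hW 1 B1 (Psi R B2) mB1 _ WPsi.
    + by rewrite ler01 lexx.
    + move=> x y; rewrite /Psi indicE in_setC in_setX/= !mul1r !indicE.
      have B12 u : u \in B2 = false -> u \in B1.
        move=> /negbT; rewrite notin_setE inE => uB2.
        by have : setT u by []; rewrite -BT => -[].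
      case: (boolP (x \in B2)) => [_|/negbTE /B12 ->] /=; last first.
        by case: (_ \in _); rewrite ?mulr1n ?mulr0n; lra.
      case: (boolP (y \in B2)) => [_|/negbTE /B12 ->] /=; first by rewrite mulr0n ltxx.
      by case: (_ \in _); rewrite ?mulr1n ?mulr0n; lra.
    + by move=> /fcov_le - /(_ hW); rewrite mul1r nuB1 /= => h <-.
  - rewrite min_sqrt_large// sqrt_quarter.
    have [] := @scaled_indic_cover _ _ _ nu W hW 2^-1 C1 (Phi R C1) mC1 _ WPhi.
    + by lra.
    + move=> x y; rewrite /Phi indicX !indicE.
      by case: (x \in C1); case: (y \in C1); rewrite ?mulr1n ?mulr0n; lra.
    + by move=> /(fcov_le hW) + sz; rewrite sz nuC1 /= mulrC.
have nu_fine (S : set T) (r : R) : measurable S -> fine (nu S) = r -> nu S = r%:E.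
  by move=> mS <-; rewrite fineK// fin_num_measure.
have nuC (S : set T) (r : R) : nu S = r%:E -> measurable S -> nu (~` S) = (1 - r)%:E.
  by move=> nuS mS; rewrite probability_setC// nuS.
have sq_fine (S : set T) (r : R) : 0 <= r ->
    fine (nu S) * fine (nu S) = r -> fine (nu S) = Num.sqrt r.
  by move=> r0 <-; rewrite -expr2 sqrtr_sqr ger0_norm// fine_ge0.
have partC (S : set T) : measurable S -> measurable_partition2 S (~` S).
  by move=> mS; split; [| exact: measurableC | exact: setICr | exact: setUv].
have mW := graphon_measurable hW.
pose prod := product_probability nu.
have heW : e = \int[prod]_z W z by rewrite he.
have iW : prod.-integrable setT (EFin \o W).
  by apply: integrable_itv01 => //; exact: graphon_range.
have := @extremal_structure _ _ _ nu W hW; rewrite -he => extremal /extremal.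
have := min_sqrt_bounds e01; set m := Num.min _ _ => -[/andP[m0 m12] m4 m2].
have mq : m <= Num.sqrt e / 2 by rewrite /m ge_min sqrt_quarter lexx.
have ms : m <= 1 - Num.sqrt (1 - e) by rewrite /m ge_min lexx orbT.
set q := Num.sqrt e in q0 qq mq *; set s := Num.sqrt (1 - e) in s0 ss ms *.
move=> [[[C mC WC] em]|[[Z mZ WZ] em]].
- have mCC : measurable (C `*` C) by exact: measurableX.
  have nuCq : nu C = q%:E.
    apply: nu_fine => //; apply: sq_fine => //.
    rewrite -Rintegral_indicX// [RHS]heW; apply: (@ae_eq_Rintegral _ _ _ prod) => //.
    by apply: filterS WC => z ->.
  (* For [e = 0] the graphon is null, which is [Psi] with [B2] the whole space; [Phi] is ruled out
     there by the condition [0.64 <= e]. *)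
  have [ez|ez] := eqVneq e 0.
    left; split; first by lra.
    exists set0, setT; split.
    + by split => //; rewrite ?set0I ?set0U.
    + by rewrite measure0 ez subr0 sqrtr1 subrr.
    + by rewrite probability_setT ez subr0 sqrtr1.
    + have : \int[prod]_z `|W z| <= 0.
        rewrite -[leRHS]ez heW le_eqVlt; apply/orP; left; apply/eqP.
        by apply: eq_Rintegral => z _; rewrite ger0_norm//; case/andP: (graphon_range hW z).
      move/(Rintegral_normr_eq0 iW); apply: filterS => z ->.
      by rewrite /Psi setXTT setCT indic0.
  (* From [e <= 4 * m^2] and [m <= 1 - s] comes [(1 - s) * (1 + s) <= 4 * (1 - s)^2]; as [e > 0],
     dividing by [1 - s] gives [s <= 3 / 5]. *)
  right; split.
    have : 0 < e by rewrite lt_neqAle eq_sym ez.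
    have : (2 * m) ^+ 2 <= (2 * (1 - s)) ^+ 2 by rewrite ler_sqr ?nnegrE; lra.
    by nra.
  exists C, (~` C); split => //; first exact: partC.
  exact: nuC.
- have mZZ : measurable (Z `*` Z) by exact: measurableX.
  have nuZ : nu Z = s%:E.
    apply: nu_fine => //; apply: sq_fine => //.
    have -> : 1 - e = \int[prod]_z (1 - W z).
      rewrite RintegralB//; last by apply: integrable_itv01 => // z; rewrite ler01 lexx.
      rewrite Rintegral_cst// [fine _](congr1 fine (probability_setT prod)).
      by rewrite mulr1 -heW.
    rewrite -Rintegral_indicX//; apply: (@ae_eq_Rintegral _ _ _ prod) => //.
      exact: measurable_funB.
    by apply: filterS WZ => z ->.
  (* Here [e <= 1 - (1 - m)^2] gives [1 - s <= m <= q / 2], so [4 * (1 - s)^2 <= (1 - s) * (1 + s)],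
     whence [3 / 5 <= s]. *)
  left; split.
    have sm : 1 - m <= s.
      have : (1 - m) ^+ 2 <= s ^+ 2 by lra.
      by rewrite ler_sqr ?nnegrE//; lra.
    have : (2 * (1 - s)) ^+ 2 <= q ^+ 2 by rewrite ler_sqr ?nnegrE; lra.
    by nra.
  exists (~` Z), Z; split => //.
  + have [? ? ZC ZT] := partC _ mZ; split => //; first by rewrite setIC.
    by rewrite setUC.
  + exact: nuC.
  + apply: filterS WZ => z; rewrite /Psi !indicE in_setC.
    by case: (z \in _) => /=; rewrite ?mulr1n ?mulr0n; lra.
Qed.
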